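(* Let $G$ be a connected cubic graph of order $n$ that is bipartite and $T^*$-free. Then $$\gamma_e(G)\leq \frac{5}{12}n+\frac{1}{2}.$$
   Context: All graphs are finite, simple and undirected. A matching $M$ in $G$ is maximal if it is maximal with respect to inclusion among matchings. The edge domination number $\gamma_e(G)$ is the minimum size of a maximal matching in $G$. $T^*$ denotes the tree obtained from the claw $K_{1,3}$ by subdividing exactly two of its edges exactly once each (so $T^*$ has $6$ vertices). A graph is $T^*$-free if it contains no induced subgraph isomorphic to $T^*$. A graph is cubic if every vertex has degree $3$. *)

(* Defs.v *)
From mathcomp Require Import all_boot all_order all_algebra.

Set Implicit Arguments.
Unset Strict Implicit.
Unset Printing Implicit Defensive.

Record sgraph := SGraph {
  vertex :> finType;
  adj : rel vertex;
  adj_sym : symmetric adj;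
  adj_irrefl : irreflexive adj }.

Section Graphs.
Variable G : sgraph.
Implicit Types (x y : G) (M : {set {set G}}).

Definition degree x : nat := #|[set y | adj x y]|.

Definition cubic : Prop := forall x, degree x = 3.

Definition connected : Prop := forall x y, connect (@adj G) x y.

Definition bipartite : Prop :=
  exists A : {set G}, forall x y, adj x y -> (x \in A) != (y \in A).

Definition edges : {set {set G}} :=
  [set [set p.1; p.2] | p : G * G & adj p.1 p.2].

Definition matching M : bool := (M \subset edges) && trivIset M.

Definition maximal_matching M : bool := maxset matching M.

(* The default value #|edges| is an upper bound for the size of any matching,
   so it does not affect the minimum; see [edge_dominationP]. *)
Definition edge_domination : nat :=
  \big[minn/#|edges|]_(M : {set {set G}} | maximal_matching M) #|M|.

Lemma edge_dominationP :
  (exists2 M, maximal_matching M & edge_domination = #|M|) /\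
  (forall M, maximal_matching M -> edge_domination <= #|M|).
Proof.
have lb M : maximal_matching M -> edge_domination <= #|M|.
  move=> mM; rewrite /edge_domination; have := mem_index_enum M.
  elim: (index_enum _) => // A r IHr; rewrite big_cons inE => /predU1P[<-|Mr].
    by rewrite mM geq_minl.
  by case: ifP => _; rewrite ?geq_min IHr ?orbT.
split=> //; have m0 : matching set0.
  by rewrite /matching sub0set; apply/trivIsetP => A B; rewrite inE.
have [M0 mM0 _] := maxset_exists m0.
case: (arg_minnP (fun M => #|M|) mM0) => M mM minM.
exists M => //; apply/eqP; rewrite eqn_leq lb //=.
rewrite /edge_domination; elim/big_ind: _ => // [|a b]; last by rewrite leq_min => -> ->.
by apply: subset_leq_card; case/maxsetP: mM => /andP[].
Qed.

Section Induced.
Variable S : {set G}.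

Definition induced_adj : rel {x : G | x \in S} := fun u v => adj (val u) (val v).

Lemma induced_adj_sym : symmetric induced_adj.
Proof. by move=> u v; apply: adj_sym. Qed.

Lemma induced_adj_irrefl : irreflexive induced_adj.
Proof. by move=> u; apply: adj_irrefl. Qed.

Definition induced : sgraph := SGraph induced_adj_sym induced_adj_irrefl.

End Induced.

End Graphs.

Definition isomorphic (G H : sgraph) : Prop :=
  exists f : G -> H, bijective f /\ forall x y : G, adj (f x) (f y) = adj x y.

Definition induced_free (H G : sgraph) : Prop :=
  forall S : {set G}, ~ isomorphic (induced S) H.

(* The claw has centre 0 and leaves 3, 4, 5; its edges 0-4 and 0-5 are
   subdivided by the new vertices 1 and 2 respectively. *)
Definition Tstar_edges : seq (nat * nat) :=
  [:: (0, 3); (0, 1); (1, 4); (0, 2); (2, 5)].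

Definition Tstar_adj : rel 'I_6 := fun i j =>
  ((val i, val j) \in Tstar_edges) || ((val j, val i) \in Tstar_edges).

Lemma Tstar_adj_sym : symmetric Tstar_adj.
Proof. by move=> i j; rewrite /Tstar_adj orbC. Qed.

Lemma Tstar_adj_irrefl : irreflexive Tstar_adj.
Proof. by case; do 6?[case=> //]. Qed.

Definition Tstar : sgraph := SGraph Tstar_adj_sym Tstar_adj_irrefl.

(* Main.v *)
Require Import Defs.
From mathcomp Require Import all_boot all_order all_algebra zify lra.

(* In a bipartite cubic graph, T*-freeness at [v] says that at most one of the
   three neighbours of [v] has a private second neighbour. It follows that
   either two neighbours of [v] are twins (have the same neighbourhood), or
   every two of them have a common neighbour not adjacent to the third one; in
   the latter case the property propagates and [G] is the cube, which has a
   maximal matching of size 3. If three vertices are pairwise twins then [G] is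
   K_{3,3}. Otherwise every neighbourhood consists of a pair of twins and one
   vertex without a twin, so [G] is a cyclic sequence of copies of K_{3,3} minus
   an edge, consecutive copies being joined by an edge between their vertices
   without twins (their ends). Choose pairwise nonconsecutive copies, half of
   them rounded down; take two edges avoiding both ends in each chosen copy and
   a perfect matching in each other copy. The uncovered vertices are
   independent, so this matching is maximal, and its size is at most
   5/2 k + 1/2 where k = n / 6 is the number of copies. *)

Set Implicit Arguments.
Unset Strict Implicit.
Unset Printing Implicit Defensive.

(** * Induced copies, and maximal matchings of bipartite graphs given as lists *)

Lemma uniq_map_inj_in (T1 T2 : eqType) (f : T1 -> T2) (s : seq T1) :
  uniq (map f s) -> {in s &, injective f}.
Proof.
elim: s => //= x s IHs /andP[fx us] y z; rewrite !inE.
case/predU1P=> [->|ys] /predU1P[->|zs] // E; last exact: IHs.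
  by rewrite E map_f in fx.
by rewrite -E map_f in fx.
Qed.

Section Embedding.
Variables (H G : sgraph) (h : H -> G).
Hypothesis h_inj : injective h.
Hypothesis h_adj : forall i j, adj (h i) (h j) = adj i j.

Lemma induced_free_no_embedding : induced_free H G -> False.
Proof.
move=> /(_ [set h i | i : H]); apply.
pose h' i : induced [set h i | i : H] := Sub (h i) (imset_f h (isT : i \in predT)).
have h'_inj : injective h' by move=> i j /(congr1 val) /= /h_inj.
have [k hk kh] : bijective h'.
  apply: inj_card_bij h'_inj _; rewrite card_sig -(card_imset predT h_inj).
  by apply: subset_leq_card; apply/subsetP => x; rewrite inE.
exists k; split; first by exists h'.
by move=> x y; rewrite -h_adj -[x in RHS]kh -[y in RHS]kh.
Qed.

End Embedding.

Section Bipartite.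
Variables (G : sgraph) (A : {set G}).
Hypothesis bip : forall x y : G, adj x y -> (x \in A) != (y \in A).

(** A vertex of [A] is never a second component, so the two [uniq] conditions make the edges
    disjoint; the last condition says that every edge meets a covered vertex, which gives
    maximality. *)
Lemma edge_domination_le (s : seq (G * G)) :
    uniq (unzip1 s) -> uniq (unzip2 s) ->
    (forall p, p \in s -> (p.1 \in A) && adj p.1 p.2) ->
    (forall x y, x \in A -> adj x y -> (x \in unzip1 s) || (y \in unzip2 s)) ->
  edge_domination G <= size s.
Proof.
move=> u1 u2 sA scov.
have side p : p \in s -> (p.1 \in A) * ((p.2 \in A) = false) * adj p.1 p.2.
  by move=> /sA/andP[pA pp]; move: (bip pp); rewrite pA pp; case: (p.2 \in A).
pose M := [set [set p.1; p.2] | p in s].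
have mM : matching M.
  apply/andP; split.
    apply/subsetP => _ /imsetP[p ps ->]; apply/imsetP; exists p => //.
    by rewrite inE side.
  apply/trivIsetP => _ _ /imsetP[p ps ->] /imsetP[q qs ->].
  apply: contraR => /pred0Pn[z /=]; rewrite !inE => /andP[zp zq].
  have [pA qA] := (side p ps, side q qs).
  suff -> : p = q by [].
  case/orP: zp zq => /eqP-> /orP[] /eqP E.
  - exact: (uniq_map_inj_in u1).
  - by have := qA.1.2; rewrite -E pA.1.1.
  - by have := pA.1.2; rewrite E qA.1.1.
  - exact: (uniq_map_inj_in u2).
have maxM : maximal_matching M.
  apply/maxsetP; split=> // M' /andP[M'E tM'] MM'.
  apply/eqP; rewrite eqEsubset MM' andbT; apply/subsetP => e eM'.
  have /imsetP[[x y]] := subsetP M'E e eM'; rewrite inE /= => xy eE.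
  (* An edge of [M'] meeting an edge of [M] equals it, since both lie in the matching [M']. *)
  have inM p z : p \in s -> z \in e -> z \in [set p.1; p.2] -> e \in M.
    move=> ps ze zp; have pM : [set p.1; p.2] \in M by apply/imsetP; exists p.
    have [->//|ne] := eqVneq e [set p.1; p.2].
    have /trivIsetP/(_ e _ eM' (subsetP MM' _ pM) ne) := tM'.
    by move/disjointFr=> /(_ z ze); rewrite zp.
  wlog xA : x y xy eE / x \in A.
    move=> hw; have [xA|xA] := boolP (x \in A); first exact: (hw x y).
    apply: (hw y x); rewrite 1?adj_sym // 1?setUC //.
    by have := bip xy; rewrite (negPf xA); case: (y \in A).
  have /orP[/mapP[p ps E]|/mapP[p ps E]] := scov x y xA xy.
    by apply: (inM p x) => //; rewrite ?eE ?E !inE eqxx.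
  by apply: (inM p y) => //; rewrite ?eE ?E !inE eqxx orbT.
have [_ /(_ M maxM) le] := edge_dominationP G.
exact: leq_trans le (leq_trans (leq_imset_card _ _) (card_size _)).
Qed.

End Bipartite.

(** * Neighbourhoods in cubic graphs *)

Definition nbrs (G : sgraph) (z : G) : {set G} := [set w | adj z w].

Section Cubic.
Variable G : sgraph.
Hypothesis G_cubic : cubic G.
Implicit Types a b c v w x y z : G.
Local Notation N := (@nbrs G).

Lemma nbrsP z w : (w \in N z) = adj z w.
Proof. by rewrite inE. Qed.

Lemma nbrs_eq z1 z2 w : N z1 = N z2 -> adj z1 w = adj z2 w.
Proof. by rewrite -!nbrsP => ->. Qed.

Lemma card_nbrs v : #|N v| = 3.
Proof. exact: G_cubic. Qed.

Lemma adj_neq z x y : adj z x -> adj z y = false -> (x == y) = false.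
Proof. by move=> zx zy; apply: contraFF zy => /eqP<-. Qed.

Lemma nbrs_seq v a b c w : uniq [:: a; b; c] ->
  adj v a -> adj v b -> adj v c -> adj v w = (w \in [:: a; b; c]).
Proof.
move=> u va vb vc; have sub : [set z in [:: a; b; c]] \subset N v.
  by apply/subsetP => z; rewrite nbrsP !inE => /or3P[] /eqP->.
have /setP/(_ w) : [set z in [:: a; b; c]] = N v.
  by apply/eqP; rewrite eqEcard sub card_nbrs cardsE (card_uniqP u).
by rewrite inE => ->; rewrite nbrsP.
Qed.

Lemma third_nbr v a b : exists c, [/\ adj v c, c != a & c != b].
Proof.
have : 0 < #|N v :\: [set a; b]|.
  rewrite cardsD card_nbrs subn_gt0 ltnS.
  rewrite (leq_trans (subset_leq_card (subsetIr _ _))) // cards2.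
  by case: (a != b).
by case/card_gt0P => c; rewrite !inE negb_or => /andP[/andP[]]; exists c.
Qed.

Lemma nbrs3 v : exists a b c,
  [/\ uniq [:: a; b; c], adj v a, adj v b & adj v c].
Proof.
have [a [va _ _]] := third_nbr v v v.
have [b [vb ba _]] := third_nbr v a a.
have [c [vc ca cb]] := third_nbr v a b.
by exists c, b, a; rewrite /= !inE negb_or ca cb ba.
Qed.

Lemma private_nbr b c : N b != N c -> exists2 x, adj b x & ~~ adj c x.
Proof.
move=> ne; have : ~~ (N b \subset N c).
  by apply: contra ne => sbc; rewrite eqEcard sbc !card_nbrs.
by case/subsetPn => x; rewrite !nbrsP; exists x.
Qed.

Lemma connected_ind (P : pred G) u :
  connected G -> P u -> (forall x y, P x -> adj x y -> P y) -> forall w, P w.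
Proof.
move=> con Pu closP w.
have clos : closed (@adj G) P.
  apply: (intro_closed (sym_connect_sym (@adj_sym G))) => x y xy Px.
  exact: closP xy.
by have := closed_connect clos (con u w); rewrite -!topredE /= Pu => <-.
Qed.

(** * Local structure of T*-free bipartite cubic graphs *)

Section Local.
Variable A : {set G}.
Hypothesis bip : forall x y, adj x y -> (x \in A) != (y \in A).

Lemma same_side v x y : adj v x -> adj v y -> adj x y = false.
Proof.
move=> /bip vx /bip vy; apply/negP => /bip.
by case: (v \in A) (x \in A) (y \in A) vx vy => [] [] [].
Qed.

(** Adjacent vertices have disjoint neighbourhoods. From 6 vertices on, the bound of the theorem is
    at least 3. *)
Lemma cubic_bipartite_order v : 6 <= #|G|.
Proof.
have [a [b [c [u va vb vc]]]] := nbrs3 v.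
have sN x y z : uniq [:: x; y; z] -> #|[set w in [:: x; y; z]]| = 3.
  by move=> ?; rewrite cardsE; apply/card_uniqP.
have -> : 6 = #|N v| + #|N a| by rewrite !card_nbrs.
rewrite -cardsUI [N v :&: N a](_ : _ = set0) ?cards0 ?addn0 ?max_card //.
apply/setP => x; rewrite inE !nbrsP inE; apply/negP => /andP[vx].
by rewrite (same_side va vx).
Qed.

Hypothesis tfree : induced_free Tstar G.

(** The centre is [v], its leaf is [a], and the long branches are [b], [p] and [c], [q].
    Bipartiteness supplies the remaining nonadjacencies. *)
Lemma Tstar_free v a b c p q : uniq [:: a; b; c] ->
  adj v a -> adj v b -> adj v c -> adj b p -> adj c q -> p != v -> q != v ->
  ~~ adj a p -> ~~ adj c p -> ~~ adj a q -> ~~ adj b q -> False.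
Proof.
move=> u va vb vc bp cq pv qv /negPf ap /negPf cp /negPf aq /negPf bq.
have pq : p != q by apply: contraFN cp => /eqP->.
have [vp vq] : adj v p = false /\ adj v q = false.
  by rewrite (same_side (x := v) (v := b)) ?(same_side (x := v) (v := c)) //
    adj_sym.
have pq' : adj p q = false.
  apply/negP => /bip; move: (bip bp) (bip cq) (bip vb) (bip vc).
  by do 5?case: (_ \in A).
have [[ab ac] bc] := (same_side va vb, same_side va vc, same_side vb vc).
(* The order follows the numbering of the vertices of [Tstar]. *)
pose h := tnth [tuple v; b; c; a; p; q].
move: u; rewrite /= !inE !negb_or => /and3P[/andP[nab nac] nbc _].
apply: (@induced_free_no_embedding Tstar G h) => //.
  have adjNeq x y : adj x y -> (x == y) = false.
    by apply: contraTF => /eqP->; rewrite adj_irrefl.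
  have far x y : adj v x -> y \in [:: p; q] -> (x == y) = false.
    by rewrite !inE => vx /orP[] /eqP->; rewrite (adj_neq vx) ?vp ?vq.
  apply/tuple_uniqP; rewrite /= !inE !negb_or nbc pq (eq_sym v p) pv (eq_sym v q) qv.
  rewrite (eq_sym b a) nab (eq_sym c a) nac !(adjNeq v) //.
  by rewrite !far // !inE eqxx ?orbT.
case=> [[|[|[|[|[|[|i]]]]]] li] [[|[|[|[|[|[|j]]]]]] lj] //.
all: rewrite /h !(tnth_nth v) /= /Tstar_adj /= ?adj_irrefl //.
all: by rewrite ?va ?vb ?vc ?bp ?cq ?ap ?cp ?aq ?bq ?ab ?ac ?bc
  ?vp ?vq ?pq' // adj_sym ?va ?vb ?vc ?bp ?cq ?ap ?cp ?aq ?bq ?ab ?ac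
  ?bc ?vp ?vq ?pq'.
Qed.

(** What is excluded is a pair of twins among the neighbours of [v], not a twin of [v]. *)
Definition twin_free v := forall b c, adj v b -> adj v c -> N b = N c -> b = c.

(** As [b] and [c] are not twins, there are [x] in [N b] outside [N c] and [z] in [N c] outside
    [N b]; neither is private, so both lie in [N a]. With [v] they fill [N a], so the third
    neighbour of [b] is outside [N a] and must lie in [N c]. *)
Lemma shared_nbrs v a b c : twin_free v -> uniq [:: a; b; c] ->
    adj v a -> adj v b -> adj v c ->
    (forall p, adj b p -> adj a p || adj c p) ->
    (forall p, adj c p -> adj a p || adj b p) ->
  [/\ exists x, [/\ adj a x, adj b x & ~~ adj c x],
      exists x, [/\ adj a x, adj c x & ~~ adj b x] &
      exists x, [/\ adj b x, adj c x & ~~ adj a x]].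
Proof.
move=> tw u va vb vc Hb Hc.
have [av bv cv] : [/\ adj a v, adj b v & adj c v] by rewrite ![adj _ v]adj_sym.
have nbc : b != c by move: u; rewrite /= !inE => /and3P[].
have [x bx cx] : exists2 x, adj b x & ~~ adj c x.
  by apply: private_nbr; apply: contraNneq nbc => /(tw _ _ vb vc)->.
have [z cz bz] : exists2 z, adj c z & ~~ adj b z.
  by apply: private_nbr; apply: contraNneq nbc => /esym/(tw _ _ vb vc)->.
have ax : adj a x by have := Hb x bx; rewrite (negPf cx) orbF.
have az : adj a z by have := Hc z cz; rewrite (negPf bz) orbF.
have xv : x != v by apply: contraNneq cx => ->.
have zv : z != v by apply: contraNneq bz => ->.
have xz : x != z by apply: contraNneq bz => <-.
have uvxz : uniq [:: v; x; z] by rewrite /= !inE negb_or !(eq_sym v) xv zv xz.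
have [y [bY yv yx]] := third_nbr b v x.
have ay : ~~ adj a y.
  rewrite (nbrs_seq y uvxz av ax az) !inE (negPf yv) (negPf yx) /=.
  by apply: contraNneq bz => <-.
have cy : adj c y by have := Hb y bY; rewrite (negPf ay).
by split; [exists x | exists z | exists y].
Qed.

(** By [Tstar_free] at most one of [a], [b], [c] has a private neighbour; that one takes the first
    role in [shared_nbrs]. *)
Lemma twin_free_shared v a b c : twin_free v -> uniq [:: a; b; c] ->
    adj v a -> adj v b -> adj v c ->
  exists x, [/\ adj a x, adj b x & ~~ adj c x].
Proof.
move=> tw u va vb vc.
have noPriv x y z : (forall p, [&& adj x p, ~~ adj y p & ~~ adj z p] = false) ->
    forall p, adj x p -> adj y p || adj z p.
  by move=> H p xp; have := H p; rewrite xp /= -negb_or => /negbFE.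
have [ucab ubac] : uniq [:: c; a; b] /\ uniq [:: b; a; c].
  move: u; rewrite /= !inE !negb_or !andbT (eq_sym c a) (eq_sym c b) (eq_sym b a).
  by case: (a == b) (a == c) (b == c) => [] [] [].
have two x y z p q : uniq [:: x; y; z] -> adj v x -> adj v y -> adj v z ->
    [&& adj y p, ~~ adj x p & ~~ adj z p] ->
    [&& adj z q, ~~ adj x q & ~~ adj y q] -> False.
  move=> uxyz vx vy vz /and3P[yp xp zp] /and3P[zq xq yq].
  apply: (Tstar_free uxyz vx vy vz yp zq) => //.
    by apply: contraNneq xp => ->; rewrite adj_sym.
  by apply: contraNneq xq => ->; rewrite adj_sym.
case: (pickP (fun p => [&& adj a p, ~~ adj b p & ~~ adj c p])) => [p Pp|/noPriv Ha].
  have Hb : forall p, adj b p -> adj a p || adj c p.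
    apply: noPriv => q; apply/negP => /and3P[bq aq cq]; case/and3P: Pp => ap bp cp.
    by apply: (two c a b p q); rewrite // ?ap ?bp ?cp ?bq ?aq ?cq.
  have Hc : forall p, adj c p -> adj a p || adj b p.
    apply: noPriv => q; apply/negP => /and3P[cq aq bq].
    by apply: (two b a c p q); rewrite // ?cq ?aq ?bq.
  by have [] := shared_nbrs tw u va vb vc Hb Hc.
case: (pickP (fun p => [&& adj b p, ~~ adj a p & ~~ adj c p])) => [p Pp|/noPriv Hb].
  have Hc : forall p, adj c p -> adj b p || adj a p.
    apply: noPriv => q; apply/negP => /and3P[cq bq aq].
    by apply: (two a b c p q); rewrite // ?bq ?aq ?cq.
  by have [[x [bx ax cx]] _ _] := shared_nbrs tw ubac vb va vc Ha Hc; exists x.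
have Ha' p : adj a p -> adj c p || adj b p by rewrite orbC; apply: Ha.
have Hb' p : adj b p -> adj c p || adj a p by rewrite orbC; apply: Hb.
by have [] := shared_nbrs tw ucab vc va vb Ha' Hb'.
Qed.

(** * The two exceptional graphs: the cube and K_{3,3} *)

Hypothesis G_connected : connected G.

(** Each of [x], [y], [z] is shared by two of [a], [b], [c], and [w] is antipodal to [v]. The three
    chosen edges leave only [v] and [w] uncovered, which are not adjacent. *)
Lemma edge_domination_cube v :
  twin_free v -> v \in A -> edge_domination G <= 3.
Proof.
move=> tw vA; have [a [b [c [u va vb vc]]]] := nbrs3 v.
have [av bv cv] : [/\ adj a v, adj b v & adj c v] by rewrite ![adj _ v]adj_sym.
have [nab nac nbc] : [/\ a != b, a != c & b != c].
  by move: u; rewrite /= !inE negb_or => /and3P[/andP[]].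
have [u1 u2] : uniq [:: a; c; b] /\ uniq [:: b; c; a].
  by rewrite /= !inE !negb_or (eq_sym c) (eq_sym c a) (eq_sym b a) nab nac nbc.
have [x [ax bx cx]] := twin_free_shared tw u va vb vc.
have [y [ay cy b_y]] := twin_free_shared tw u1 va vc vb.
have [z [bz cz az]] := twin_free_shared tw u2 vb vc va.
have [xv yv zv] : [/\ x != v, y != v & z != v].
  split; [by apply: contraNneq cx => -> | by apply: contraNneq b_y => ->|].
  by apply: contraNneq az => ->.
have [xy xz yz] : [/\ x != y, x != z & y != z].
  split; [by apply: contraNneq cx => -> | by apply: contraNneq cx => -> |].
  by apply: contraNneq b_y => ->.
have Na : forall p, adj a p = (p \in [:: v; x; y]).
  move=> p; apply: nbrs_seq => //.
  by rewrite /= !inE negb_or !(eq_sym v) xv yv xy.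
have Nb : forall p, adj b p = (p \in [:: v; x; z]).
  move=> p; apply: nbrs_seq => //.
  by rewrite /= !inE negb_or !(eq_sym v) xv zv xz.
have Nc : forall p, adj c p = (p \in [:: v; y; z]).
  move=> p; apply: nbrs_seq => //.
  by rewrite /= !inE negb_or !(eq_sym v) yv zv yz.
(* The neighbours [v], [x], [y] of [a] are told apart by their adjacencies to [b] and [c]. *)
have twa : twin_free a.
  move=> p q; rewrite !Na !inE => Hp Hq E; move: (nbrs_eq b E) (nbrs_eq c E).
  rewrite ![adj _ b]adj_sym ![adj _ c]adj_sym.
  by case/or3P: Hp => /eqP->; case/or3P: Hq => /eqP-> //;
    rewrite ?bv ?cv ?bx ?(negPf cx) ?cy ?(negPf b_y).
have twb : twin_free b.
  move=> p q; rewrite !Nb !inE => Hp Hq E; move: (nbrs_eq a E) (nbrs_eq c E).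
  rewrite ![adj _ a]adj_sym ![adj _ c]adj_sym.
  by case/or3P: Hp => /eqP->; case/or3P: Hq => /eqP-> //;
    rewrite ?av ?cv ?ax ?(negPf cx) ?cz ?(negPf az).
have [w [xw yw vw]] : exists w, [/\ adj x w, adj y w & ~~ adj v w].
  apply: (twin_free_shared twa) => //.
  by rewrite /= !inE negb_or xv yv xy.
have [w' [xw' zw' vw']] : exists w, [/\ adj x w, adj z w & ~~ adj v w].
  apply: (twin_free_shared twb) => //.
  by rewrite /= !inE negb_or xv zv xz.
have [wa wb wc] : [/\ w != a, w != b & w != c].
  by split; apply: contraNneq vw => ->.
have Nx : forall p, adj x p = (p \in [:: a; b; w]).
  move=> p; apply: nbrs_seq; rewrite // 1?adj_sym //.
  by rewrite /= !inE negb_or !(eq_sym _ w) nab wa wb.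
(* [N x] consists of [a], [b], [w], and [a], [b] are adjacent to [v]; hence [w'] is [w]. *)
have zw : adj z w.
  have := xw'; rewrite Nx !inE => /or3P[] /eqP E; last by rewrite -E.
    by rewrite E va in vw'.
  by rewrite E vb in vw'.
have Ny : forall p, adj y p = (p \in [:: a; c; w]).
  move=> p; apply: nbrs_seq; rewrite // 1?adj_sym //.
  by rewrite /= !inE negb_or !(eq_sym _ w) nac wa wc.
have Nz : forall p, adj z p = (p \in [:: b; c; w]).
  move=> p; apply: nbrs_seq; rewrite // 1?adj_sym //.
  by rewrite /= !inE negb_or !(eq_sym _ w) nbc wb wc.
have Nw : forall p, adj w p = (p \in [:: x; y; z]).
  move=> p; apply: nbrs_seq; rewrite // 1?adj_sym //.
  by rewrite /= !inE negb_or xy xz yz.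
have Nv p : adj v p = (p \in [:: a; b; c]) by apply: nbrs_seq.
(* The eight vertices are closed under adjacency, so connectedness leaves no others. *)
have all8 : forall p, p \in [:: v; x; y; z; a; b; c; w].
  apply: (@connected_ind _ v) => //; first by rewrite inE eqxx.
  move=> p q; rewrite !inE => /or4P[||| /or4P[||| /orP[]]] /eqP->;
    by rewrite ?Nv ?Nx ?Ny ?Nz ?Na ?Nb ?Nc ?Nw !inE => /or3P[] ->; rewrite ?orbT.
have sA p q : adj p q -> p \in A -> (q \in A) = false.
  by move=> /bip; case: (p \in A) (q \in A) => [] [].
have sB p q : adj p q -> (p \in A) = false -> q \in A.
  by move=> /bip; case: (p \in A) (q \in A) => [] [].
have [aA bA cA] : [/\ (a \in A) = false, (b \in A) = false & (c \in A) = false].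
  by split; apply: (sA v).
have [xA yA zA] : [/\ x \in A, y \in A & z \in A].
  by split; [apply: sB ax _|apply: sB ay _|apply: sB bz _].
apply: (edge_domination_le bip (s := [:: (x, a); (y, c); (z, b)])).
- by rewrite /= !inE negb_or xy xz yz.
- by rewrite /= !inE negb_or nac nab eq_sym nbc.
- by move=> p; rewrite !inE => /or3P[] /eqP-> /=;
    rewrite ?xA ?yA ?zA ?Nx ?Ny ?Nz !inE eqxx ?orbT.
move=> p q pA; have := all8 p; rewrite !inE.
case/or4P => [||| /or4P[||| /orP[]]] /eqP E; rewrite E in pA *.
all: rewrite ?eqxx ?orbT //.
- by rewrite Nv !inE => /or3P[] ->; rewrite ?orbT.
- by rewrite aA in pA.
- by rewrite bA in pA.
- by rewrite cA in pA.
- by rewrite (sA x w) in pA.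
Qed.

(** Three pairwise twins and their common neighbours are closed under adjacency, hence all of [G]; a
    perfect matching has 3 edges. *)
Lemma edge_domination_K33 p q r : uniq [:: p; q; r] ->
  N p = N q -> N p = N r -> p \in A -> edge_domination G <= 3.
Proof.
move=> u pq pr pA; have [x [y [z [u' px py pz]]]] := nbrs3 p.
have Np t : adj p t = (t \in [:: x; y; z]) by apply: nbrs_seq.
have Nq t : adj q t = (t \in [:: x; y; z]) by rewrite -(nbrs_eq _ pq).
have Nr t : adj r t = (t \in [:: x; y; z]) by rewrite -(nbrs_eq _ pr).
have Nxyz s t : s \in [:: x; y; z] -> adj s t = (t \in [:: p; q; r]).
  by move=> sN; apply: nbrs_seq; rewrite // adj_sym ?Np ?Nq ?Nr.
have Npqr s t : s \in [:: p; q; r] -> adj s t = (t \in [:: x; y; z]).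
  by rewrite !inE => /or3P[] /eqP->; rewrite ?Np ?Nq ?Nr !inE.
have all6 : forall t, (t \in [:: p; q; r]) || (t \in [:: x; y; z]).
  apply: (@connected_ind _ p) => //; first by rewrite inE eqxx.
  by move=> s t /orP[] H; rewrite ?(Npqr _ _ H) ?(Nxyz _ _ H) => ->; rewrite ?orbT.
have sA s t : adj s t -> s \in A -> (t \in A) = false.
  by move=> /bip; case: (s \in A) (t \in A) => [] [].
have xyzA t : t \in [:: x; y; z] -> (t \in A) = false.
  by rewrite -Np => /sA; apply.
have pqrA t : t \in [:: p; q; r] -> t \in A.
  have xN : x \in [:: x; y; z] by rewrite inE eqxx.
  by rewrite -(Nxyz x) // => /bip; rewrite (xyzA x xN); case: (t \in A).
apply: (edge_domination_le bip (s := [:: (p, x); (q, y); (r, z)])) => //.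
  move=> t; rewrite !inE => /or3P[] /eqP-> /=;
    by rewrite pqrA ?Np ?Nq ?Nr !inE ?eqxx ?orbT.
move=> s t sA' _; have /orP[->//|/xyzA] := all6 s; by rewrite sA'.
Qed.

End Local.
End Cubic.

(** * Cyclic sequences of copies of K_{3,3} minus an edge *)

Section Necklace.
Variables (G : sgraph) (A : {set G}).
Hypothesis G_connected : connected G.
Hypothesis bip : forall x y : G, adj x y -> (x \in A) != (y \in A).
Implicit Types u v w x y z : G.
Local Notation N := (@nbrs G).

(** [T] stands for having a twin; [t z] and [t' z] are the twins among the neighbours of [z], and
    [s z] is the remaining neighbour. *)
Variables (T : pred G) (t t' s : G -> G).
Hypothesis adjE : forall z w, adj z w = (w \in [:: t z; t' z; s z]).
Hypothesis t_neq : forall z, t z != t' z.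
Hypothesis nbrs_t' : forall z, N (t' z) = N (t z).
Hypothesis Tt : forall z, T (t z).
Hypothesis Tt' : forall z, T (t' z).
Hypothesis Ts : forall z, ~~ T (s z).

Lemma adj_t z : adj z (t z). Proof. by rewrite adjE inE eqxx. Qed.
Lemma adj_t' z : adj z (t' z). Proof. by rewrite adjE !inE eqxx orbT. Qed.
Lemma adj_s z : adj z (s z). Proof. by rewrite adjE !inE eqxx !orbT. Qed.

Lemma adj_side x y : adj x y -> (y \in A) = (x \notin A).
Proof. by move/bip; case: (x \in A) (y \in A) => [] []. Qed.

Lemma adj_single z w : adj z w -> ~~ T w -> s z = w.
Proof.
by rewrite adjE !inE => /or3P[] /eqP-> //; rewrite ?Tt ?Tt'.
Qed.

Lemma adj_twin z w : adj z w -> T w -> N w = N (t z).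
Proof.
by rewrite adjE !inE => /or3P[] /eqP-> //; rewrite (negPf (Ts z)).
Qed.

Lemma adj_twin2 z w1 w2 : adj z w1 -> adj z w2 -> T w1 -> T w2 -> N w1 = N w2.
Proof. by move=> zw1 zw2 /(adj_twin zw1)-> /(adj_twin zw2)->. Qed.

Lemma s_nbrs x y : N x = N y -> s x = s y.
Proof. by move=> E; apply: adj_single (Ts y); rewrite (nbrs_eq _ E) adj_s. Qed.

(** For twins [x] and [y], [t] may pick different members of the same pair, so only the
    neighbourhoods agree. *)
Lemma t_nbrs x y : N x = N y -> N (t x) = N (t y).
Proof.
move=> E; apply: (adj_twin2 (z := x)); rewrite ?Tt ?adj_t //.
by rewrite (nbrs_eq _ E) adj_t.
Qed.

Lemma s_s z : ~~ T z -> s (s z) = z.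
Proof. by apply: adj_single; rewrite adj_sym adj_s. Qed.

Lemma s_t z : ~~ T z -> s (t z) = z.
Proof. by apply: adj_single; rewrite adj_sym adj_t. Qed.

(* Every vertex lies in a copy of K_{3,3} minus an edge; [y] and [opp y] are
   the two nonadjacent vertices of that copy. *)
Definition opp y := s (t (t y)).

(** The way back from [opp y] passes through twins of the vertices on the way out, and [s] takes
    equal values on twins. *)
Lemma opp_opp y : ~~ T y -> opp (opp y) = y.
Proof.
move=> Ty; rewrite -[RHS](s_t Ty); apply: s_nbrs.
set v := t (t y); have va : adj (s v) v by rewrite adj_sym adj_s.
have Nv : N (t (s v)) = N v by apply: adj_twin2 (adj_t _) va (Tt _) (Tt _).
rewrite (t_nbrs Nv).
by apply: adj_twin2 (adj_t v) _ (Tt _) (Tt _); rewrite adj_sym adj_t.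
Qed.

Lemma opp_side y : (opp y \in A) = (y \notin A).
Proof.
by rewrite (adj_side (adj_s _)) (adj_side (adj_t _)) (adj_side (adj_t _)) negbK.
Qed.

(** From an end, cross the joining edge and go to the other end of the copy reached. Fixing the
    vertices with a twin makes [next] injective on all of [G], so its orbits are cycles. *)
Definition next y := if T y then y else opp (s y).

Lemma next_inj : injective next.
Proof.
have nT y : ~~ T (opp y) by apply: Ts.
move=> x y; rewrite /next; case: ifP => [Tx|/negbT Tx]; case: ifP => [Ty|/negbT Ty] //.
- by move=> E; have := nT (s y); rewrite -E Tx.
- by move=> E; have := nT (s x); rewrite E Ty.
by move/(congr1 opp); rewrite !opp_opp // => /(congr1 s); rewrite !s_s.
Qed.

Lemma next_end y : ~~ T y -> ~~ T (next y).
Proof. by move=> Ty; rewrite /next (negPf Ty) Ts. Qed.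

Lemma next_side y : (next y \in A) = (y \in A).
Proof.
by rewrite /next; case: (T y) => //; rewrite opp_side (adj_side (adj_s y)) negbK.
Qed.

(* The end in [A] of the copy of a vertex of [A], resp. of its complement. *)
Definition rootA u := if T u then s (t u) else u.
Definition rootB w := if T w then s w else opp w.

Lemma rootA_end u : ~~ T (rootA u).
Proof. by rewrite /rootA; case: ifP => [_|->//]; apply: Ts. Qed.

(** An edge with an endpoint in [T] stays inside a copy; an edge between two ends leads to the next
    copy. *)
Lemma rootB_adj u w : adj u w ->
  rootB w = if T u || T w then rootA u else next (rootA u).
Proof.
move=> uw; have wu : adj w u by rewrite adj_sym.
rewrite /rootA /rootB; have [Tu|Tu] := boolP (T u); have [Tw|Tw] := boolP (T w) => /=.
- by apply: s_nbrs; apply: adj_twin.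
- by apply/s_nbrs/t_nbrs/esym; apply: adj_twin.
- exact: adj_single.
- by rewrite /next (negPf Tu) (adj_single uw).
Qed.

Lemma rootA_block u : u \in [:: rootA u; t (t (rootA u)); t' (t (rootA u))].
Proof.
rewrite /rootA; case: ifP => [Tu|_]; last by rewrite inE eqxx.
set y := s (t u); have yu : adj y (t u) by rewrite adj_sym adj_s.
have Ny : N (t y) = N (t u) by apply/esym/adj_twin.
have : adj (t y) u by rewrite (nbrs_eq _ Ny) adj_sym adj_t.
rewrite adjE !inE; case/or3P=> [->|->|/eqP E]; rewrite ?orbT //.
by move: Tu; rewrite E (negPf (Ts _)).
Qed.

Lemma rootA_adj y z : ~~ T y -> adj (t y) z -> rootA z = y.
Proof.
move=> Ty yz; rewrite /rootA; case: ifP => [Tz|/negbT Tz].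
  rewrite -[RHS](s_t Ty); apply: s_nbrs.
  by apply: adj_twin2 (adj_t z) _ (Tt _) (Tt _); rewrite adj_sym.
by rewrite -[RHS](s_t Ty) (adj_single yz).
Qed.

(** * The cycle of copies and the matching that skips alternate ends *)

Variable y0 : G.
Hypothesis y0_end : ~~ T y0.
Hypothesis y0A : y0 \in A.

Lemma orbit_props y : fconnect next y0 y -> ~~ T y /\ y \in A.
Proof.
move/iter_findex <-; elim: (findex _ _ _) => //= i [Ti iA].
by rewrite next_end // next_side.
Qed.

(** Along an edge the root stays or moves by [next]; since [next] is injective, lying in the orbit
    of [y0] is preserved in both directions. *)
Lemma rootA_orbit u : u \in A -> fconnect next y0 (rootA u).
Proof.
pose P u := fconnect next y0 (if u \in A then rootA u else rootB u).
suff: P u by rewrite /P => + uA; rewrite uA.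
apply: (connected_ind G_connected (u := y0)); rewrite /P.
  by rewrite y0A /rootA (negPf y0_end) connect0.
have step x y : adj x y ->
    fconnect next y0 (rootB y) = fconnect next y0 (rootA x).
  move/rootB_adj->; case: ifP => // _; apply/esym/same_fconnect1_r/next_inj.
move=> x y + xy; rewrite (adj_side xy); case: (x \in A) => /=.
  by rewrite (step x y).
by rewrite (step y x) // adj_sym.
Qed.

(* The ends in [A] of the chosen copies: every other vertex of the cycle of
   [next], so that the chosen copies are nonconsecutive even if it is odd. *)
Definition skip := [set y | fconnect next y0 y && odd (findex next y0 y)].

(** Skipped ends have odd positions. The successor has an even one, also when it wraps around to
    position 0. *)
Lemma next_skip y : y \in skip -> next y \notin skip.
Proof.
rewrite !inE => /andP[y0y]; have lt := findex_max y0y.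
move: (iter_findex y0y) lt; set j := findex _ _ _ => <- lt oj.
rewrite -iterS negb_and.
have [lt'|ge] := ltnP j.+1 (order next y0); first by rewrite findex_iter //= oj orbT.
have -> : j.+1 = order next y0 by apply/eqP; rewrite eqn_leq lt ge.
by rewrite (iter_order next_inj) findex0 orbT.
Qed.

Lemma skip_end y : y \in skip -> ~~ T y /\ y \in A.
Proof. by rewrite inE => /andP[/orbit_props]. Qed.

Lemma card_skip : (order next y0)./2 <= #|skip|.
Proof.
set k := order next y0; pose h (i : 'I_k./2) := iter i.*2.+1 next y0.
have hk (i : 'I_k./2) : i.*2.+1 < k.
  by have := ltn_ord i; have := odd_double_half k; lia.
have h_inj : injective h.
  move=> i j /(congr1 (findex next y0)); rewrite !findex_iter // => -[].
  by move/double_inj/val_inj.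
rewrite -[k./2]card_ord -(card_imset predT h_inj).
apply/subset_leq_card/subsetP => _ /imsetP[i _ ->].
by rewrite inE fconnect_iter findex_iter //= odd_double.
Qed.

(** By [rootA_block] each copy has at most three vertices in [A], and every copy is reached from
    [y0]. *)
Lemma card_side : #|A| <= 3 * order next y0.
Proof.
pose O := [set y | fconnect next y0 y].
have cO : #|O| = order next y0 by rewrite cardsE.
have sub : A \subset O :|: ([set t (t y) | y in O] :|: [set t' (t y) | y in O]).
  apply/subsetP => u uA; have yO : rootA u \in O by rewrite inE rootA_orbit.
  rewrite !in_setU; have := rootA_block u; rewrite !inE.
  case/or3P => /eqP E; [apply/orP; left | apply/or3P/Or32 | apply/or3P/Or33].
  - by rewrite E; move: yO; rewrite inE.
  - by rewrite E; apply: imset_f.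
  - by rewrite E; apply: imset_f.
apply: leq_trans (subset_leq_card sub) _; rewrite -cO mulSn mul2n -addnn.
apply: leq_trans (leq_card_setU _ _) (leq_add (leqnn _) _).
by apply: leq_trans (leq_card_setU _ _) (leq_add _ _); apply: leq_imset_card.
Qed.

(* In the copy with end [y] in [A] the pairs are [t (t y), t' y] and, unless [y]
   is skipped, [y, t y] and [t' (t y), opp y]; otherwise [t' (t y), t y]. *)
Definition partner z :=
  let y := rootA z in
  if z == y then t y else if z == t (t y) then t' y
  else if y \in skip then t y else s z.

Lemma partner_adj z : adj z (partner z).
Proof.
rewrite /partner; set y := rootA z.
have [->|zy] := eqVneq z y; first exact: adj_t.
have ty : adj (t y) z.
  have := rootA_block z; rewrite -/y inE (negPf zy) /= !inE => /orP[] /eqP->.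
    exact: adj_t.
  exact: adj_t'.
case: ifP => _; first by rewrite adj_sym (nbrs_eq _ (nbrs_t' y)).
by case: ifP => _; [rewrite adj_sym | apply: adj_s].
Qed.

(** Every chosen edge stays inside one copy, so injectivity of [partner] can be checked copy by
    copy. *)
Lemma rootB_partner z : rootB (partner z) = rootA z.
Proof.
rewrite (rootB_adj (partner_adj z)); case: ifP => // /norP[Tz].
by rewrite /partner /rootA (negPf Tz) eqxx Tt.
Qed.

(** Inside a copy only [t y] could be used twice, by [y] and by [t' (t y)]; this happens only if [y]
    is skipped, and then [y] is left out. *)
Lemma partner_inj : {in A :\: skip &, injective partner}.
Proof.
move=> z1 z2; rewrite !in_setD => /andP[S1 _] /andP[S2 _] E.
have Ey : rootA z1 = rootA z2 by rewrite -!rootB_partner E.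
move: (rootA_block z1) (rootA_block z2) E; rewrite /partner -Ey.
have := rootA_end z1; set y := rootA z1 => Ty.
have tne := negPf (t_neq y); have tne' : (t' y == t y) = false by rewrite eq_sym.
have sT a : (s a == t y) = false by apply: contraTF (Tt y) => /eqP<-; apply: Ts.
have sT' a : (s a == t' y) = false by apply: contraTF (Tt' y) => /eqP<-; apply: Ts.
rewrite !in_cons !in_nil !orbF.
case: (eqVneq z1 y) S1 => [->|_] S1; case: (eqVneq z2 y) S2 => [->|_] S2 //=.
- move=> _ _; case: ifP => [_ /eqP|_]; first by rewrite tne.
  by rewrite (negPf S1) => /eqP; rewrite eq_sym sT.
- move=> _ _; case: ifP => [_ /eqP|_]; first by rewrite tne'.
  by rewrite (negPf S2) => /eqP; rewrite sT.
case: (eqVneq z1 (t (t y))) => [->|_]; case: (eqVneq z2 (t (t y))) => [->|_] //=.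
- by move=> _ _; case: ifP => _ /eqP; rewrite ?tne' // eq_sym sT'.
- by move=> _ _; case: ifP => _ /eqP; rewrite ?tne // sT'.
by move=> /eqP-> /eqP->.
Qed.

Lemma edge_domination_skip : edge_domination G <= #|A :\: skip|.
Proof.
rewrite cardE; set X := enum _.
rewrite -(size_map (fun z => (z, partner z)) X).
have mX z : (z \in X) = (z \notin skip) && (z \in A) by rewrite mem_enum inE.
have TX z : T z -> z \in A -> z \in X.
  by move=> Tz zA; rewrite mX zA andbT; apply: contraL Tz => /skip_end[].
apply: (edge_domination_le bip).
- by rewrite /unzip1 -map_comp map_id enum_uniq.
- rewrite /unzip2 -map_comp map_inj_in_uniq ?enum_uniq //.
  by move=> x y; rewrite !mem_enum; apply: partner_inj.
- by move=> _ /mapP[z zX ->] /=; rewrite partner_adj andbT;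
    move: zX; rewrite mX => /andP[].
move=> x w xA xw; rewrite /unzip1 /unzip2 -!map_comp map_id mX xA andbT.
have [xS|//] := boolP (x \in skip) => /=.
have [Tx _] := skip_end xS; have ttA z : z \in A -> (t (t z) \in A) && (t' (t z) \in A).
  by move=> zA; rewrite (adj_side (adj_t _)) (adj_side (adj_t' _))
    (adj_side (adj_t _)) zA.
have /andP[vA zA] := ttA x xA.
have Tne a b : T a -> ~~ T b -> (a == b) = false.
  by move=> Ta; apply: contraNF => /eqP<-.
have neT z : (t' z == t z) = false by rewrite eq_sym; apply: negbTE.
move: xw; rewrite adjE !inE => /or3P[] /eqP->; apply/mapP.
- exists (t' (t x)); first by rewrite TX.
  by rewrite /= /partner (rootA_adj Tx (adj_t' _)) (Tne _ x) // neT xS.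
- exists (t (t x)); first by rewrite TX.
  by rewrite /= /partner (rootA_adj Tx (adj_t _)) (Tne _ x) // eqxx.
(* [s x] is [opp (next x)], and it is covered because the end [next x] is not skipped. *)
have /negPf nS := next_skip xS; have nT := next_end Tx.
set y := next x in nS nT; have yA : y \in A by rewrite next_side.
have /andP[_ zA'] := ttA y yA.
exists (t' (t y)); first by rewrite TX.
rewrite /= /partner (rootA_adj nT (adj_t' _)) (Tne _ y) // neT nS.
rewrite -[LHS](opp_opp (Ts _)) /opp; rewrite /y /next (negPf Tx) -/(opp (s x)).
by apply: s_nbrs; rewrite nbrs_t'.
Qed.

(** With k the order of [next] at [y0], the size is at most |A| - (k - 1)/2, where k >= |A|/3 and
    |A| <= n/2. *)
Lemma edge_domination_necklace :
  2 * #|A| <= #|G| -> 12 * edge_domination G <= 5 * #|G| + 6.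
Proof.
move=> leA; have le1 := edge_domination_skip; have le2 := card_skip.
have le3 := card_side.
have : #|A :\: skip| = #|A| - #|skip|.
  rewrite cardsD (setIidPr _) //; apply/subsetP => y /skip_end[//].
have := odd_double_half (order next y0).
lia.
Qed.

End Necklace.

(** * Case distinction and the numerical bound *)

Definition has_twin (G : sgraph) (u : G) : bool :=
  [exists u', (u' != u) && (nbrs u' == nbrs u)].

(** A twin of the third neighbour of [z] would be adjacent to [z], hence one of the other two
    neighbours, giving three pairwise twins. *)
Lemma nbrs_twins (G : sgraph) (z : G) : cubic G -> ~ twin_free z ->
    (forall p q r : G, uniq [:: p; q; r] -> nbrs p = nbrs q -> nbrs p <> nbrs r) ->
  exists p : G * G * G,
    [/\ forall w, adj z w = (w \in [:: p.1.1; p.1.2; p.2]),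
        p.1.1 != p.1.2, nbrs p.1.2 = nbrs p.1.1,
        has_twin p.1.1 && has_twin p.1.2 & ~~ has_twin p.2].
Proof.
move=> cub ntw ntr.
have [b [c [zb zc bc E]]] : exists b c, [/\ adj z b, adj z c, b != c & nbrs b = nbrs c].
  have [/existsP[b /existsP[c /and4P[? ? ? /eqP ?]]]|H] :=
    boolP [exists b, exists c, [&& adj z b, adj z c, b != c & nbrs b == nbrs c]].
    by exists b, c.
  case: ntw => b c zb zc E; apply/eqP; apply: contraNT H => bc.
  by apply/existsP; exists b; apply/existsP; exists c; rewrite zb zc bc E /=.
have [a [za ab ac]] := third_nbr cub z b c.
have u : uniq [:: b; c; a] by rewrite /= !inE negb_or bc !(eq_sym _ a) ab ac.
have adjE w := nbrs_seq cub w u zb zc za.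
exists (b, c, a); split=> //=.
  apply/andP; split; apply/existsP; [exists c | exists b].
    by rewrite eq_sym bc E /=.
  by rewrite bc E /=.
apply/existsP => -[a' /andP[a'a /eqP Ea]].
have : adj z a' by rewrite adj_sym (nbrs_eq _ Ea) adj_sym.
rewrite adjE !inE (negPf a'a) orbF => /orP[] /eqP E'; subst a'.
  exact: (ntr b c a u E).
by apply: (ntr b c a u E); rewrite E.
Qed.

Lemma edge_domination_nat (G : sgraph) :
    connected G -> cubic G -> bipartite G -> induced_free Tstar G ->
  12 * edge_domination G <= 5 * #|G| + 6.
Proof.
move=> con cub [A bipA] tf.
have bipC x y : adj x y -> (x \in ~: A) != (y \in ~: A).
  by move/bipA; rewrite !inE; case: (x \in A) (y \in A) => [] [].
have small (v : G) : edge_domination G <= 3 -> 12 * edge_domination G <= 5 * #|G| + 6.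
  have := cubic_bipartite_order cub bipA v; lia.
have chooseSide (v : G) : exists2 B : {set G},
    (forall x y, adj x y -> (x \in B) != (y \in B)) & v \in B.
  by have [vA|vA] := boolP (v \in A); [exists A | exists (~: A); rewrite ?inE].
have [-> //|e_gt0] := posnP (edge_domination G).
(* Without vertices the empty list contradicts [e_gt0]. *)
have [v _|G0] := pickP G; last first.
  have := edge_domination_le bipA (s := [::]) isT isT.
  rewrite leqNgt e_gt0 => H; suff: false by [].
  by apply: H => // x; have := G0 x.
have tw_or (w : G) : twin_free w -> edge_domination G <= 3.
  by move=> tw; have [B bipB wB] := chooseSide w; apply: edge_domination_cube tw wB.
have tr_or (p q r : G) : uniq [:: p; q; r] -> nbrs p = nbrs q -> nbrs p = nbrs r ->
    edge_domination G <= 3.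
  move=> u pq pr; have [B bipB pB] := chooseSide p.
  exact: edge_domination_K33 u pq pr pB.
have [/(small v)//|gt3] := leqP (edge_domination G) 3.
(* A [twin_free] vertex or three pairwise twins would now give 3 < 3. *)
have /fin_all_exists[f fP] (z : G) := nbrs_twins (z := z) cub
  (fun tw => notF (leq_trans gt3 (tw_or z tw)))
  (fun p q r u pq pr => notF (leq_trans gt3 (tr_or p q r u pq pr))).
have {chooseSide} [B bipB leB] : exists2 B : {set G},
    (forall x y, adj x y -> (x \in B) != (y \in B)) & 2 * #|B| <= #|G|.
  have := cardsC A; have [leA|ltA] := leqP (2 * #|A|) #|G|; first by exists A.
  by exists (~: A) => //; lia.
pose s z := (f z).2.
have Ts z : ~~ has_twin (s z) by have [] := fP z.
(* [s v] and [s (s v)] are adjacent ends, so one of them lies in [B]. *)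
have [y0 Ty0 y0B] : exists2 y, ~~ has_twin y & y \in B.
  have [sB|sB] := boolP (s v \in B); first by exists (s v).
  exists (s (s v)) => //; have : adj (s v) (s (s v)).
    by have [-> _ _ _ _] := fP (s v); rewrite !inE eqxx !orbT.
  by move/bipB; rewrite (negPf sB); case: (_ \in B).
apply: (@edge_domination_necklace G B con bipB (@has_twin G) (fun z => (f z).1.1)
  (fun z => (f z).1.2) s _ _ _ _ _ Ts y0) => // z; have [] := fP z => //.
- by move=> _ _ _ /andP[].
- by move=> _ _ _ /andP[].
Qed.

Theorem theorem2 (G : sgraph) (G_connected : connected G) (G_cubic : cubic G)
    (G_bipartite : bipartite G) (G_Tstar_free : induced_free Tstar G) :
  ((edge_domination G)%:R <= 5 / 12 * #|G|%:R + 1 / 2 :> rat)%R.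
Proof.
have := edge_domination_nat G_connected G_cubic G_bipartite G_Tstar_free.
rewrite -(Num.Theory.ler_nat rat) GRing.natrD !GRing.natrM; lra.
Qed.
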